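(* Let $n\geq 3$, let $Q_1,Q_2,Q_3$ be real symmetric $n\times n$ matrices, and let $g_i:\mathbb{R}^n\to\mathbb{R}$, $g_i(x)=x^\top Q_i x$ for $i\in\{1,2,3\}$. Assume there is a linear combination of $Q_1,Q_2,Q_3$ (with real coefficients) that is positive definite. Then \[ \{x\in\mathbb{R}^n : g_i(x)<0,\ i\in\{1,2,3\}\}=\emptyset \iff \exists\,\lambda\in\mathbb{R}^3_+\setminus\{0\} \text{ such that } \sum_{i=1}^3\lambda_i Q_i\succeq 0. \]
   Context: $\mathbb{R}^3_+$ is the set of vectors in $\mathbb{R}^3$ with all entries nonnegative. For a symmetric matrix $M$, $M\succeq 0$ means $M$ is positive semidefinite. *)

(* Defs.v *)
From HB Require Import structures.
From mathcomp Require Import all_boot all_order all_algebra.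
From mathcomp Require Import boolp classical_sets reals.

Set Implicit Arguments.
Unset Strict Implicit.
Unset Printing Implicit Defensive.

Import Order.TTheory GRing.Theory Num.Theory.
Local Open Scope ring_scope.

(* x^T M x, extracted from the 1 x 1 product matrix. *)
Definition qform (R : realType) (n : nat) (M : 'M[R]_n) (x : 'cV[R]_n) : R :=
  (x^T *m M *m x) 0 0.

(* Semidefiniteness and definiteness are notions for symmetric matrices only,
   so symmetry is part of both predicates. *)
Definition psdmx (R : realType) (n : nat) (M : 'M[R]_n) : Prop :=
  M \is symmetricmx /\ forall x : 'cV[R]_n, 0 <= qform M x.

Definition pdmx (R : realType) (n : nat) (M : 'M[R]_n) : Prop :=
  M \is symmetricmx /\ forall x : 'cV[R]_n, x != 0 -> 0 < qform M x.

(* Main.v *)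
Require Import Defs.
From HB Require Import structures.
From mathcomp Require Import all_boot all_order all_algebra.
From mathcomp Require Import boolp classical_sets reals.
From mathcomp Require Import ring lra.

(** If lambda is nonnegative and nonzero, no x can make all g_i negative while
    sum_i lambda_i g_i(x) >= 0; this is the easy direction. For the converse,
    the joint range C = { (g_1(x), g_2(x), g_3(x)) } is a convex cone
    ([joint_range_convex_cone]); if it misses the open negative orthant, it lies
    on the nonnegative side of a hyperplane with nonnegative normal lambda
    ([cone_alternative]), and that says that sum_i lambda_i Q_i is positive
    semidefinite.

    Convexity is where n >= 3 and the positive definite combination h enter.
    Given a = g(x) and b = g(y), put c = a + b. It suffices to find z <> 0 with
    g(z) on the line spanned by c: since h is positive at g(z) and at c, the two
    vectors then lie on the same ray, and rescaling z gives g(z) = c. When a and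
    b are not parallel, the line spanned by c is cut out by the two linear
    functionals with vectors N = a x b and N x c. Composing these with g gives
    two quadratic forms B and A such that B(x) = B(y) = 0 and A(x) < 0 < A(y),
    and z must be a common zero of them. It is found by the intermediate value
    theorem along a polynomial curve from x to y, or from x to -y, on the quadric
    B = 0 ([ge3_common_zero]). In the plane spanned by x and y this quadric may
    consist of two lines only, which is why a third direction is needed.

    The separation of C from the orthant needs no closedness of C: by induction
    on the dimension it reduces to the plane, where it amounts to the existence
    of a supremum ([alternative2]). *)

Set Implicit Arguments.
Unset Strict Implicit.
Unset Printing Implicit Defensive.

Import Order.TTheory GRing.Theory Num.Theory.
Local Open Scope classical_set_scope.
Local Open Scope ring_scope.

(** * Convex cones that miss the open negative orthant *)

(** Only positive multiples are required, so that the part of a cone lying in an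
    open half-space is again a cone. *)
Definition convex_cone (R : realType) (m : nat) (C : set ('I_m -> R)) : Prop :=
  (forall a b, C a -> C b -> C (fun i => a i + b i)) /\
  (forall k a, 0 < k -> C a -> C (fun i => k * a i)).

(** Each point (a, b) of D with a < 0 forces mu >= - a / (b - a), and each point
    with b < 0 forces mu <= a / (a - b). If a bound of the first kind exceeded
    one of the second kind, a positive combination of the two points would have
    both coordinates negative; so the supremum of the lower bounds is a valid
    mu. *)
Lemma alternative2 (R : realType) (D : R -> R -> Prop)
    (hadd : forall a b a' b', D a b -> D a' b' -> D (a + a') (b + b'))
    (hscale : forall k a b, 0 < k -> D a b -> D (k * a) (k * b))
    (hneg : forall a b, D a b -> a < 0 -> 0 <= b) :
  exists2 mu : R, 0 <= mu <= 1 &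
    forall a b, D a b -> 0 <= (1 - mu) * a + mu * b.
Proof.
pose S : set R := [set s | s = 0 \/
  exists a b, [/\ D a b, a < 0 & s = - a / (b - a)]].
have S0 : S 0 by left.
have S1 : ubound S 1.
  move=> s [->|[a [b [Dab a0 ->]]]]; first exact: ler01.
  have b0 := hneg _ _ Dab a0.
  by rewrite ler_pdivrMr; lra.
have supS : has_ubound S by exists 1.
have mu0 : 0 <= sup S by apply: ub_le_sup.
have mu1 : sup S <= 1 by apply: ge_sup => //; exists 0.
exists (sup S); first by rewrite mu0.
move=> a b Dab; have [a0|a0] := ltP a 0.
  have b0 := hneg _ _ Dab a0.
  have : - a / (b - a) <= sup S by apply: ub_le_sup => //; right; exists a, b.
  by rewrite ler_pdivrMr; lra.
have [b0|b0] := leP 0 b; first by apply: addr_ge0; apply: mulr_ge0; lra.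
suff : sup S <= a / (a - b) by rewrite ler_pdivlMr; lra.
apply: ge_sup; first by exists 0.
move=> s [->|[a' [b' [Dab' a'0 ->]]]]; first by apply: divr_ge0; lra.
have b'0 := hneg _ _ Dab' a'0.
rewrite ler_pdivrMr; last lra.
rewrite mulrAC ler_pdivlMr; last lra.
rewrite leNgt; apply/negP => lt_ab.
(* With these weights both coordinates of the combination of (a', b') and
   (a, b) are equal to a * b' - b * a', which is negative by lt_ab. *)
have ab0 : 0 < a - b by lra.
have ba'0 : 0 < b' - a' by lra.
have Dz := hadd _ _ _ _ (hscale _ _ _ ab0 Dab') (hscale _ _ _ ba'0 Dab).
have := hneg _ _ Dz; nra.
Qed.

(** The slice of C where the first coordinate is negative projects to a cone D in
    one dimension less that misses the negative orthant. A multiplier la for D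
    merges all the remaining coordinates into the single number
    sum_i la_i c_(i+1), which leaves a problem in the plane. *)
Lemma cone_alternative (R : realType) (m : nat) (C : set ('I_m.+1 -> R)) :
    convex_cone C -> (forall c, C c -> ~ forall i, c i < 0) ->
  exists lambda : 'I_m.+1 -> R,
    [/\ forall i, 0 <= lambda i, exists i, lambda i != 0 &
        forall c, C c -> 0 <= \sum_i lambda i * c i].
Proof.
elim: m C => [|m IHm] C [Cadd Cscale] Cneg.
  exists (fun=> 1); split=> [i||c Cc]; first exact: ler01.
    by exists 0; exact: oner_neq0.
  rewrite big_ord1 mul1r leNgt; apply/negP => c0.
  by apply: (Cneg c Cc) => i; rewrite ord1.
pose D : set ('I_m.+1 -> R) := [set d | exists c,
  [/\ C c, c ord0 < 0 & forall i, d i = c (lift ord0 i)]].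
have [||la [la0 [j laj] laD]] := IHm D.
- split=> [a b [c [Cc c0 ac]] [d [Cd d0 bd]]|k a k0 [c [Cc c0 ac]]].
    exists (fun i => c i + d i); split=> [||i]; first exact: Cadd.
      by rewrite -(addr0 0) ltrD.
    by rewrite ac bd.
  exists (fun i => k * c i); split=> [||i]; first exact: Cscale.
    by rewrite pmulr_rlt0.
  by rewrite ac.
- move=> d [c [Cc c0 dc]] d0; apply: (Cneg c Cc) => i.
  by case: (unliftP ord0 i) => [k|] -> //; rewrite -dc.
pose E (a b : R) := exists c, [/\ C c, a = c ord0 &
  b = \sum_i la i * c (lift ord0 i)].
have [|||mu /andP[mu0 mu1] muE] := @alternative2 R E.
- move=> a b a' b' [c [Cc -> ->]] [d [Cd -> ->]].
  exists (fun i => c i + d i); split=> //; first exact: Cadd.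
  by rewrite -big_split /=; apply: eq_bigr => i _; rewrite mulrDr.
- move=> k a b k0 [c [Cc -> ->]].
  exists (fun i => k * c i); split=> //; first exact: Cscale.
  by rewrite mulr_sumr; apply: eq_bigr => i _; rewrite mulrCA.
- by move=> a b [c [Cc -> ->]] c0; apply: laD; exists c.
exists (fun i => if unlift ord0 i is Some k then mu * la k else 1 - mu).
split=> [i||c Cc].
- by case: (unlift ord0 i) => [k|]; [exact: mulr_ge0 | rewrite subr_ge0].
- have [mu_0|mu_n0] := eqVneq mu 0.
    by exists ord0; rewrite unlift_none mu_0 subr0 oner_neq0.
  by exists (lift ord0 j); rewrite liftK mulf_neq0.
- rewrite big_ord_recl unlift_none.
  under eq_bigr => i _ do rewrite liftK -mulrA.
  by rewrite -mulr_sumr; apply: muE; exists c.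
Qed.

(** * Symmetric bilinear forms *)

(** Stated over any commutative ring because it is also evaluated at vectors of
    polynomials. *)
Definition bform (R : comNzRingType) (n : nat) (M : 'M[R]_n) (x y : 'cV[R]_n) : R :=
  (x^T *m M *m y) 0 0.

Section Forms.
Variables (R : realType) (n : nat).
Implicit Types (M : 'M[R]_n) (x y u v w : 'cV[R]_n).

Lemma symmetricmxP M : reflect (M^T = M) (M \is symmetricmx).
Proof.
rewrite qualifE /= expr0 scale1r map_mx_id //.
by apply: (iffP eqP) => /esym.
Qed.

Lemma bformC M x y : M \is symmetricmx -> bform M x y = bform M y x.
Proof.
move=> /symmetricmxP symM; rewrite /bform.
transitivity ((x^T *m M *m y)^T 0 0); first by rewrite [RHS]mxE.
by rewrite !trmx_mul trmxK symM mulmxA.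
Qed.

Lemma bformDl M x y z : bform M (x + y) z = bform M x z + bform M y z.
Proof. by rewrite /bform linearD /= !mulmxDl mxE. Qed.

Lemma bformDr M x y z : bform M z (x + y) = bform M z x + bform M z y.
Proof. by rewrite /bform mulmxDr mxE. Qed.

Lemma bformZl M k x z : bform M (k *: x) z = k * bform M x z.
Proof. by rewrite /bform linearZ /= -!scalemxAl mxE. Qed.

Lemma bformZr M k x z : bform M z (k *: x) = k * bform M z x.
Proof. by rewrite /bform -scalemxAr mxE. Qed.

Lemma qformE M x : qform M x = bform M x x. Proof. by []. Qed.

Lemma qformZ M k x : qform M (k *: x) = k ^+ 2 * qform M x.
Proof. by rewrite !qformE bformZl bformZr; ring. Qed.

Lemma bform0r M x : bform M x 0 = 0.
Proof. by rewrite /bform mulmx0 mxE. Qed.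

Lemma qform0 M : qform M 0 = 0. Proof. exact: bform0r. Qed.

Lemma qform_sum (I : finType) (mu : I -> R) (Q : I -> 'M[R]_n) x :
  qform (\sum_i mu i *: Q i) x = \sum_i mu i * qform (Q i) x.
Proof.
rewrite /qform mulmx_sumr mulmx_suml summxE; apply: eq_bigr => i _.
by rewrite -scalemxAr -scalemxAl mxE.
Qed.

Lemma symmetricmx_sum (I : finType) (mu : I -> R) (Q : I -> 'M[R]_n) :
  (forall i, Q i \is symmetricmx) -> \sum_i mu i *: Q i \is symmetricmx.
Proof.
move=> symQ; apply/symmetricmxP; rewrite raddf_sum; apply: eq_bigr => i _ /=.
by rewrite linearZ /=; move/symmetricmxP: (symQ i) ->.
Qed.

(** Two linear equations in more than two unknowns. *)
Lemma exists_orthogonal2 M u v : (2 < n)%N ->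
  exists w, [/\ w != 0, bform M u w = 0 & bform M v w = 0].
Proof.
move=> n3; pose K := col_mx (u^T *m M) (v^T *m M).
have : kermx K^T != 0.
  rewrite kermx_eq0 /row_free; apply: contraTneq n3 => <-.
  by rewrite -leqNgt rank_leq_col.
move=> /rowV0Pn[r /sub_kermxP rK r0].
exists r^T; have : K *m r^T = 0 by rewrite -[K]trmxK -trmx_mul rK trmx0.
rewrite mul_col_mx -col_mx0 => /eq_col_mx[Hu Hv].
by split; [rewrite trmx_eq0 | rewrite /bform Hu mxE | rewrite /bform Hv mxE].
Qed.

(** Along a polynomial curve a quadratic form is a polynomial in the parameter,
    so the intermediate value theorem for polynomials is all the topology that
    is needed. *)
Lemma curve_zero M (p : 'cV[{poly R}]_n) :
  let at_ t := map_mx (horner_eval t) p in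
  qform M (at_ 0) <= 0 <= qform M (at_ 1) ->
  exists2 t, 0 <= t <= 1 & qform M (at_ t) = 0.
Proof.
move=> at_; pose P := bform (map_mx polyC M) p p.
have PE t : P.[t] = qform M (at_ t).
  transitivity (map_mx (horner_eval t) (p^T *m map_mx polyC M *m p) 0 0).
    by rewrite [RHS]mxE.
  rewrite !map_mxM -map_trmx -map_mx_comp map_mx_id // => a /=.
  exact: hornerC.
rewrite -!PE => /(poly_ivt ler01)[t t01 /rootP Pt].
by exists t; rewrite -?PE.
Qed.

Lemma eval_const_curve (q : {poly R}) u t :
  map_mx (horner_eval t) (q *: map_mx polyC u) = q.[t] *: u.
Proof. by apply/matrixP => i j; rewrite !mxE horner_evalE hornerM hornerC. Qed.

(** * Common zeros of two quadratic forms *)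

Section CommonZero.
Variables A B : 'M[R]_n.
Hypothesis symB : B \is symmetricmx.

Let common_zero := exists z, [/\ z != 0, qform A z = 0 & qform B z = 0].

(** B vanishes on the whole plane of u and v, hence on the segment from u to v,
    which avoids 0: A <= 0 on the multiples of u and A >= 0 on the multiples of
    v, with equality only at 0. *)
Lemma segment_common_zero u v :
    qform A u < 0 < qform A v -> qform B u = 0 -> qform B v = 0 ->
  bform B u v = 0 -> common_zero.
Proof.
move=> /andP[Au Av] Bu Bv Buv.
pose p : 'cV[{poly R}]_n :=
  (1 - 'X) *: map_mx polyC u + 'X *: map_mx polyC v.
have pE t : map_mx (horner_eval t) p = (1 - t) *: u + t *: v.
  by rewrite map_mxD !eval_const_curve !hornerE.
have [|t _ At] := @curve_zero A p.
  by rewrite !pE subr0 subrr !scale1r !scale0r addr0 add0r !ltW.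
exists ((1 - t) *: u + t *: v); split; last 1 first.
- rewrite qformE !(bformDl, bformDr, bformZl, bformZr) -!qformE.
  by rewrite Bu Bv (bformC v u symB) Buv; ring.
- apply/eqP => /(canRL (addrK _)); rewrite sub0r -scaleNr => /(congr1 (qform A)).
  rewrite !qformZ sqrrN => e.
  have [t0|t0] := eqVneq t 0; first by move: e; rewrite t0; lra.
  have : 0 < t ^+ 2 * qform A v by rewrite mulr_gt0 // exprn_even_gt0.
  by rewrite -e ltNge nmulr_lle0 // sqr_ge0.
- by rewrite -pE.
Qed.

(** The curve (1-t)^2 u + k t(1-t) w + t^2 v joins u to v, and B takes on it the
    value t^2 (1-t)^2 (2 B(u,v) + k^2 B(w)), which the sign condition allows to
    cancel by the choice of k. It is a parametrized arc of a plane conic, seen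
    projectively. *)
Lemma conic_common_zero u v w :
    qform A u < 0 < qform A v -> qform B u = 0 -> qform B v = 0 ->
    bform B u w = 0 -> bform B v w = 0 -> bform B u v * qform B w < 0 ->
  common_zero.
Proof.
move=> /andP[Au Av] Bu Bv Buw Bvw bc.
have c0 : qform B w != 0 by apply: contraTneq bc => ->; rewrite mulr0 ltxx.
pose k := Num.sqrt (- 2 * bform B u v / qform B w).
have k2 : k ^+ 2 * qform B w = - 2 * bform B u v.
  rewrite sqr_sqrtr ?divfK //.
  have -> : - 2 * bform B u v / qform B w =
      - 2 * (bform B u v * qform B w) / qform B w ^+ 2 by field.
  by rewrite divr_ge0 ?sqr_ge0 //; lra.
pose p : 'cV[{poly R}]_n := (1 - 'X) ^+ 2 *: map_mx polyC u
  + (k%:P * 'X * (1 - 'X)) *: map_mx polyC w + 'X ^+ 2 *: map_mx polyC v.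
have pE t : map_mx (horner_eval t) p =
    (1 - t) ^+ 2 *: u + (k * t * (1 - t)) *: w + t ^+ 2 *: v.
  by rewrite !map_mxD !eval_const_curve !hornerE.
have [|t _ At] := @curve_zero A p.
  rewrite !pE subr0 subrr !mulr0 mul0r expr0n expr1n /= !scale1r !scale0r.
  by rewrite !addr0 !add0r !ltW.
exists ((1 - t) ^+ 2 *: u + (k * t * (1 - t)) *: w + t ^+ 2 *: v).
split; last 1 first.
- rewrite qformE !(bformDl, bformDr, bformZl, bformZr) -!qformE.
  rewrite Bu Bv (bformC v u symB) (bformC w u symB) (bformC w v symB) Buw Bvw.
  have -> : k * t * (1 - t) * (k * t * (1 - t) * qform B w) =
     (t * (1 - t)) ^+ 2 * (k ^+ 2 * qform B w) by ring.
  by rewrite k2; ring.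
(* Pairing with v shows that the curve can meet 0 only at t = 1, where it is at
   v <> 0. *)
- apply/eqP => z0; have := congr1 (bform B v) z0.
  rewrite !(bformDr, bformZr) Bvw (bformC v u symB) -qformE Bv.
  rewrite bform0r !mulr0 !addr0 => /eqP.
  rewrite mulf_eq0 sqrf_eq0 subr_eq0 => /orP[/eqP t1|/eqP b0]; last first.
    by move: bc; rewrite b0 mul0r ltxx.
  move: z0 Av; rewrite -t1 subrr mulr0 expr0n expr1n /= !scale0r !add0r scale1r.
  by move=> ->; rewrite qform0 ltxx.
- by rewrite -pE.
Qed.

(** Let w be B-orthogonal to u and v. If B(u,v) and B(w) are nonzero, u is joined
    by a conic to v or to -v, depending on the signs. If B(w) = 0 instead, B
    vanishes on the segments from u to w and from w to v, and A changes sign on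
    one of them unless w itself is a zero of A. *)
Lemma ge3_common_zero u v : (2 < n)%N ->
    qform A u < 0 < qform A v -> qform B u = 0 -> qform B v = 0 ->
  common_zero.
Proof.
move=> n3 Auv Bu Bv; have [b0|b0] := eqVneq (bform B u v) 0.
  exact: (@segment_common_zero u v).
have [w [w0 Buw Bvw]] := exists_orthogonal2 B u v n3.
have [c0|c0|c0] := ltgtP (bform B u v * qform B w) 0.
- exact: (@conic_common_zero u v w).
- have Nv M : qform M (- v) = qform M v.
    by rewrite -scaleN1r qformZ sqrrN expr1n mul1r.
  apply: (@conic_common_zero u (- v) w); rewrite ?Nv //.
    by rewrite -scaleN1r bformZl Bvw mulr0.
  by rewrite -scaleN1r bformZr mulN1r mulNr oppr_lt0.
- have Bw : qform B w = 0 by move/eqP: c0; rewrite mulf_eq0 (negPf b0) => /eqP.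
  move/andP: Auv => [Au Av].
  have [Aw|Aw|Aw] := ltgtP (qform A w) 0; last by exists w.
  + by apply: (@segment_common_zero w v); rewrite ?Aw // bformC.
  + by apply: (@segment_common_zero u w); rewrite ?Au.
Qed.

End CommonZero.
End Forms.

(** * Vectors of dimension three *)

Section Vectors3.
Variable R : realType.
Implicit Types a b c d : 'I_3 -> R.

Definition dot a b : R := \sum_i a i * b i.

(** The indices are added modulo 3. *)
Definition cross a b (i : 'I_3) : R :=
  a (i + 1) * b (i + 2) - a (i + 2) * b (i + 1).

Lemma dotE a b : dot a b = a 0 * b 0 + a 1 * b 1 + a 2 * b 2.
Proof.
rewrite /dot !big_ord_recl big_ord0 addr0 addrA.
by congr (_ + a _ * b _ + a _ * b _); apply: val_inj.
Qed.

Lemma crossE a b : [/\ cross a b 0 = a 1 * b 2 - a 2 * b 1,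
  cross a b 1 = a 2 * b 0 - a 0 * b 2 & cross a b 2 = a 0 * b 1 - a 1 * b 0].
Proof.
rewrite /cross !add0r.
have -> : 1 + 1 = 2 :> 'I_3 by apply: val_inj.
have -> : 1 + 2 = 0 :> 'I_3 by apply: val_inj.
have -> : 2 + 1 = 0 :> 'I_3 by apply: val_inj.
by have -> : 2 + 2 = 1 :> 'I_3 by apply: val_inj.
Qed.

Lemma ord3_ind (P : 'I_3 -> Prop) : P 0 -> P 1 -> P 2 -> forall i, P i.
Proof.
move=> P0 P1 P2 [[|[|[|//]]] i3].
- by rewrite (_ : Ordinal i3 = 0) //; apply: val_inj.
- by rewrite (_ : Ordinal i3 = 1) //; apply: val_inj.
- by rewrite (_ : Ordinal i3 = 2) //; apply: val_inj.
Qed.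

(** If c is orthogonal to N, then N and N x c cut out the line of c: both c and d
    are orthogonal to N, so c x d is a multiple of N, and its component
    N . (c x d) = (N x c) . d is zero. *)
Lemma cross_eq0_of_dot N c d :
    dot N N != 0 -> dot N c = 0 -> dot N d = 0 -> dot (cross N c) d = 0 ->
  forall i, cross c d i = 0.
Proof.
move=> N0 Nc Nd Ncd i; apply: (mulfI N0); rewrite mulr0.
have -> : dot N N * cross c d i = dot (cross N c) d * N i
    + dot N c * cross N d i - dot N d * cross N c i.
  have [x0 x1 x2] := crossE c d; have [y0 y1 y2] := crossE N c.
  have [z0 z1 z2] := crossE N d.
  elim/ord3_ind: i; rewrite !dotE ?x0 ?x1 ?x2 ?y0 ?y1 ?y2 ?z0 ?z1 ?z2; ring.
by rewrite Nc Nd Ncd; ring.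
Qed.

(** Lagrange's identity mu x (c x d) = (mu . d) c - (mu . c) d. *)
Lemma parallel_of_cross_eq0 mu c d : (forall i, cross c d i = 0) ->
  forall i, dot mu c * d i = dot mu d * c i.
Proof.
move=> cd i; apply/eqP; rewrite -subr_eq0.
have -> : dot mu c * d i - dot mu d * c i = - cross mu (cross c d) i.
  have [x0 x1 x2] := crossE c d; have [y0 y1 y2] := crossE mu (cross c d).
  by elim/ord3_ind: i; rewrite !dotE ?y0 ?y1 ?y2 ?x0 ?x1 ?x2; ring.
have -> : cross c d = fun=> 0 by apply/funext.
by rewrite /cross !mulr0 subrr oppr0.
Qed.

End Vectors3.

(** * Convexity of the joint range *)

Section JointRange.
Variables (R : realType) (n : nat) (Q : 'I_3 -> 'M[R]_n) (mu : 'I_3 -> R).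
Hypothesis n3 : (2 < n)%N.
Hypothesis symQ : forall i, Q i \is symmetricmx.
Hypothesis pdQ : forall x, x != 0 -> 0 < dot mu (fun i => qform (Q i) x).

(** A point of the joint range parallel to c is a positive multiple of c, since
    the positive definite combination is positive at both. *)
Lemma joint_range_ray (c : 'I_3 -> R) z :
    z != 0 -> 0 < dot mu c -> (forall i, cross c (fun j => qform (Q j) z) i = 0) ->
  exists x, forall i, qform (Q i) x = c i.
Proof.
move=> z0 hc /(parallel_of_cross_eq0 mu) par.
have hz := pdQ z0; set d := (fun j => qform (Q j) z) in par hz.
exists (Num.sqrt (dot mu c / dot mu d) *: z) => i.
rewrite qformZ sqr_sqrtr; last by rewrite divr_ge0 ?ltW.
by rewrite mulrAC par mulrAC mulfV ?mul1r // gt_eqF.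
Qed.

(** For x and y with values a and b, the proof looks for z with value on the line
    of c = a + b. If a and b are parallel, z = x will do; otherwise z is a common
    zero of the forms with coefficients N = a x b and N x c. *)
Lemma joint_range_convex_cone :
  convex_cone [set a | exists x, forall i, a i = qform (Q i) x].
Proof.
split=> [a b [x ax] [y b_y]|k a k0 [x ax]]; last first.
  exists (Num.sqrt k *: x) => i.
  by rewrite qformZ sqr_sqrtr ?ltW // ax.
have [x0|x0] := eqVneq x 0; first by exists y => i; rewrite ax x0 qform0 add0r.
pose c i := a i + b i.
have dotD u : dot u c = dot u a + dot u b.
  by rewrite !dotE /c; ring.
have ha : 0 < dot mu a.
  by rewrite /dot; under eq_bigr => i _ do rewrite ax; exact: pdQ.
have hb : 0 <= dot mu b.
  rewrite /dot; under eq_bigr => i _ do rewrite b_y.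
  have [->|y0] := eqVneq y 0; last exact/ltW/pdQ.
  by rewrite big1 // => i _; rewrite qform0 mulr0.
have hc : 0 < dot mu c by rewrite dotD; lra.
suff [z z0 cz] : exists2 z, z != 0 &
    forall i, cross c (fun j => qform (Q j) z) i = 0.
  by have [t tc] := joint_range_ray z0 hc cz; exists t => i; rewrite tc.
pose N := cross a b.
have [N0 N1 N2] : [/\ N 0 = a 1 * b 2 - a 2 * b 1,
  N 1 = a 2 * b 0 - a 0 * b 2 & N 2 = a 0 * b 1 - a 1 * b 0] by exact: crossE.
have [NN|NN] := eqVneq (dot N N) 0.
  exists x => // i; have [y0 y1 y2] := crossE c (fun j => qform (Q j) x).
  have [N00 N10 N20] : [/\ N 0 = 0, N 1 = 0 & N 2 = 0].
    by move: NN; rewrite dotE => NN; split; nra.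
  move: N00 N10 N20; rewrite N0 N1 N2 => N00 N10 N20.
  by elim/ord3_ind: i; rewrite ?y0 ?y1 ?y2 -!ax /c; lra.
have NNgt0 : 0 < dot N N by move: NN; rewrite dotE => NN; rewrite lt0r NN; nra.
pose A := \sum_i cross N c i *: Q i.
pose B := \sum_i N i *: Q i.
have AE v : qform A v = dot (cross N c) (fun i => qform (Q i) v) by exact: qform_sum.
have BE v : qform B v = dot N (fun i => qform (Q i) v) by exact: qform_sum.
have [M0 M1 M2] := crossE N c.
have Na : dot N a = 0 by rewrite dotE N0 N1 N2; ring.
have Nb : dot N b = 0 by rewrite dotE N0 N1 N2; ring.
(* N x c = (N x a) + (N x b), and (N x b) . a = - (N . N) = - (N x a) . b: the
   values of A at x and y have opposite signs. *)
have Ma : dot (cross N c) a = - dot N N.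
  by rewrite !dotE M0 M1 M2 N0 N1 N2 /c; ring.
have Mb : dot (cross N c) b = dot N N.
  by rewrite !dotE M0 M1 M2 N0 N1 N2 /c; ring.
have dax u : dot u (fun i => qform (Q i) x) = dot u a.
  by apply: eq_bigr => i _; rewrite ax.
have dby u : dot u (fun i => qform (Q i) y) = dot u b.
  by apply: eq_bigr => i _; rewrite b_y.
have [||||z [z0 Az Bz]] := @ge3_common_zero _ _ A B _ x y n3.
- exact: symmetricmx_sum.
- by rewrite !AE dax dby Ma Mb oppr_lt0 NNgt0.
- by rewrite BE dax.
- by rewrite BE dby.
exists z => //; apply: (cross_eq0_of_dot NN); rewrite -?AE -?BE //.
by rewrite dotD Na Nb addr0.
Qed.

End JointRange.

Theorem lemma1 (R : realType) (n : nat) (hn : (3 <= n)%N)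
    (Q : 'I_3 -> 'M[R]_n) (hQ : forall i, Q i \is symmetricmx)
    (g : 'I_3 -> 'cV[R]_n -> R) (hg : forall i x, g i x = qform (Q i) x)
    (hpd : exists mu : 'cV[R]_3, pdmx (\sum_(i < 3) mu i 0 *: Q i)) :
  [set x : 'cV[R]_n | forall i : 'I_3, g i x < 0] = set0 <->
  exists lambda : 'cV[R]_3,
    [/\ forall i : 'I_3, 0 <= lambda i 0, lambda != 0 &
        psdmx (\sum_(i < 3) lambda i 0 *: Q i)].
Proof.
split=> [g0|[la [la0 la_n0 [_ psd]]]].
  have [mu [_ pd]] := hpd.
  have hmu x : x != 0 -> 0 < dot (mu ^~ 0) (fun i => qform (Q i) x).
    by move=> /pd; rewrite qform_sum.
  have [|la [la0 [j laj] laC]] :=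
    cone_alternative (joint_range_convex_cone hn hQ hmu).
    move=> c [x cx] c0; have : [set x | forall i, g i x < 0] x.
      by move=> i; rewrite hg -cx.
    by rewrite g0.
  exists (\col_i la i); split=> [i||].
  - by rewrite mxE.
  - by apply: contra_neq laj => /(congr1 (fun u : 'cV_3 => u j 0)); rewrite !mxE.
  - split=> [|x]; first exact: symmetricmx_sum.
    under eq_bigr do rewrite mxE.
    by rewrite qform_sum; apply: laC; exists x.
apply/seteqP; split=> // x /= gx.
have := psd x; rewrite qform_sum leNgt => /negP; apply.
have [j laj] : exists j, la j 0 != 0.
  apply/existsP; apply: contra_neqT la_n0; rewrite negb_exists => /forallP la_0.
  by apply/colP => j; rewrite mxE; apply/eqP; have := la_0 j; rewrite negbK.
rewrite (bigD1 j) //= -[ltRHS](addr0 0); apply: ltr_leD.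
  by rewrite -hg pmulr_rlt0 // lt0r laj la0.
by apply: sumr_le0 => i _; rewrite mulr_ge0_le0 // -hg ltW.
Qed.
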